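(* Suppose that $\kappa>\omega_1$ is a cardinal of uncountable cofinality and that $X$ is a Banach space of density $\kappa$ whose dual $X^*$ contains an isomorphic copy of $L_1(\{0,1\}^\kappa)$. Then $X$ does not admit an overcomplete set.
   Context: All Banach spaces are infinite dimensional and over the reals. $dens(X)$ (the density) is the minimal cardinality of a norm dense subset of $X$. A subset $Y$ of a Banach space $X$ is called overcomplete (in $X$) if $|Y|=dens(X)$ and every $Z\subseteq Y$ with $|Z|=|Y|$ is linearly dense in $X$ (its linear span is norm dense in $X$). $L_1(\{0,1\}^\kappa)$ means $L_1(\mu)$ for $\mu$ the homogeneous probability product measure on $\{0,1\}^\kappa$. *)

(* Defs.v *)
From HB Require Import structures.
From mathcomp Require Import all_boot all_order all_algebra.
From mathcomp Require Import all_classical all_reals all_analysis.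
From mathcomp Require wochoice.

Set Implicit Arguments.
Unset Strict Implicit.
Unset Printing Implicit Defensive.

Import Order.TTheory GRing.Theory Num.Theory.
Import numFieldNormedType.Exports.

Local Open Scope classical_set_scope.
Local Open Scope card_scope.
Local Open Scope ring_scope.

(* Cardinals are initial von Neumann ordinals: a type K with a (reflexive)
   well-order le, in which no proper initial segment is equinumerous to K.   *)

Definition initial_segment (K : Type) (le : rel K) (a : K) : set K :=
  [set b | le b a /\ b <> a].

Definition is_cardinal (K : Type) (le : rel K) : Prop :=
  wochoice.well_order le /\
  forall a, ~ (initial_segment le a #= [set: K]).

(* The first uncountable ordinal is a member of K, i.e., is one of its proper
   initial segments.                                                         *)
Definition omega1_lt (K : Type) (le : rel K) : Prop :=
  exists a, ~ countable (initial_segment le a) /\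
    forall b, initial_segment le a b -> countable (initial_segment le b).

Definition cofinal (K : Type) (le : rel K) (C : set K) : Prop :=
  forall a, exists2 c, C c & le a c.

Definition uncountable_cofinality (K : Type) (le : rel K) : Prop :=
  forall C : set K, cofinal le C -> ~ countable C.

Definition has_density (X : topologicalType) (T : Type) (A : set T) : Prop :=
  (exists2 D : set X, dense D & D #= A) /\
  forall D : set X, dense D -> A #<= D.

Definition L1_norm d (T : measurableType d) (R : realType)
    (mu : {measure set T -> \bar R}) (f : T -> R) : R :=
  fine ('N[mu]_1[EFin \o f])%E.

Section Banach.
Context (R : realType) (X : normedModType R).

Definition linear_span (Z : set X) : set X :=
  [set x | exists n (c : 'I_n -> R) (z : 'I_n -> X),
     (forall i, Z (z i)) /\ x = \sum_(i < n) c i *: z i].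

Definition linearly_dense (Z : set X) : Prop := dense (linear_span Z).

Definition overcomplete (Y : set X) : Prop :=
  has_density X Y /\
  forall Z : set X, Z `<=` Y -> Z #= Y -> linearly_dense Z.

Definition dual_space : set (X -> R^o) :=
  [set phi | linear phi /\ continuous phi].

Definition dual_norm (phi : X -> R^o) : R :=
  sup [set `|phi x| | x in [set x : X | `|x| <= 1]].

(* LfunType mu (lexx 1) consists of the integrable functions themselves, before
   identification of almost everywhere equal ones; the upper bound forces J to
   factor through this identification, so that J is the same thing as an
   isomorphic embedding of the Banach space L_1(mu) into the dual. *)
Definition dual_contains_L1 d (T : measurableType d)
    (mu : {measure set T -> \bar R}) : Prop :=
  exists (J : {linear LfunType mu (lexx 1%E) -> (X -> R^o)}) (c C : R),
    [/\ 0 < c, 0 < C, forall f, dual_space (J f) &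
      forall f : LfunType mu (lexx 1%E),
        c * L1_norm mu f <= dual_norm (J f) <= C * L1_norm mu f].

End Banach.

Definition cube_sets (K : Type) : set (set (K -> bool)) :=
  \bigcup_(k in [set: K])
    preimage_set_system setT (fun x : K -> bool => x k) measurable.

(* {0,1}^K with the product sigma-algebra *)
Definition cube (K : Type) := g_sigma_algebraType (@cube_sets K).
HB.instance Definition _ (K : Type) := Measurable.on (cube K).

(* mu is the product of fair coins; by the pi-lambda theorem this determines mu
   among the probabilities on the cube.                                      *)
Definition is_fair_product (R : realType) (K : Type)
    (mu : probability (cube K) R) : Prop :=
  forall n (k : 'I_n -> K), injective k -> forall B : 'I_n -> set bool,
    mu [set x : K -> bool | forall i, B i (x (k i))] =
    (\prod_(i < n) bernoulli_prob (2^-1 : R) (B i))%E.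

(* Main.v *)
Require Import Defs.
From HB Require Import structures.
From mathcomp Require Import all_boot all_order all_algebra.
From mathcomp Require Import all_classical all_reals all_analysis.
From mathcomp Require Import measurable_realfun ring lra.

Import Order.TTheory GRing.Theory Num.Theory.
Import numFieldNormedType.Exports.

Local Open Scope classical_set_scope.
Local Open Scope ring_scope.

(* Let r_k be the Rademacher function of the coordinate k. A bounded functional
   on L_1(mu) is nonzero on only countably many r_k: if |phi r_k| >= e for
   infinitely many k, then for every m the signed sum f of m^2 such r_k would
   satisfy m^2 e <= |phi f| <= M |f|_1 <= M |f|_2 = M m. Hence each y in X is
   annihilated by J r_k for all but countably many k. If Y were overcomplete,
   each nonzero functional J r_k would annihilate fewer than |K| elements of Y;
   since |K| > omega_1, a counting argument then yields some y in Y with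
   J r_k y <> 0 for uncountably many k, a contradiction. *)

Set Implicit Arguments.
Unset Strict Implicit.

(** * Comparison and products of cardinals *)

Local Open Scope card_scope.

(** [G] need not be single-valued: choice picks a value for each point of [A], and different points
    share no value. Relations are easier to glue than functions between subtypes. *)
Lemma card_le_relP (T U : Type) (A : set T) (B : set U) :
  A #<= B <-> exists G : T -> U -> Prop,
    (forall x, A x -> exists2 y, B y & G x y) /\
    forall x x' y, A x -> A x' -> G x y -> G x' y -> x = x'.
Proof.
split=> [/card_leP[f]|[G [GB Ginj]]].
  exists (fun x y => exists a : A, val a = x /\ val (f a) = y); split.
    move=> x Ax; pose a : A := SigSub (mem_set Ax).
    by exists (val (f a)); [exact: set_mem (valP (f a))|exists a].
  move=> _ _ y _ _ [a [<- <-]] [a' [<- /val_inj faa']].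
  by congr val; apply: (@inj _ _ _ f) => //; rewrite inE.
have /choice[f fG] (a : A) : exists b : B, G (val a) (val b).
  have [y By Gy] := GB _ (set_mem (valP a)).
  by exists (SigSub (mem_set By)).
apply/card_leP/injfunPex; exists f => // a a' _ _ faa'.
by apply/val_inj/(Ginj _ _ (val (f a)));
  first [exact: set_mem (valP _)|exact: fG|rewrite faa'; exact: fG].
Qed.

Lemma card_le_subset (T U : Type) (A : set T) (B : set U) :
  A #<= B -> exists2 C : set U, C `<=` B & C #= A.
Proof.
move=> /card_leP[f]; exists ((val \o f) @` [set: A]).
  by move=> _ [a _ <-]; exact: set_mem (valP (f a)).
apply: (card_eq_trans _ (card_setT A)); apply: inj_card_eq.
by move=> a b aT bT /val_inj; exact: inj.
Qed.

Lemma infinite_set_inj_nat (T : Type) (A : set T) :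
  infinite_set A -> exists f : nat -> T, injective f /\ forall n, A (f n).
Proof.
move=> /infiniteP/card_le_relP[G [GA Ginj]].
have /choice[f fP] n : exists y, A y /\ G n y.
  by have [y] := GA n I; exists y.
exists f; split=> [n m fnm|n]; last by have [] := fP n.
have [_ Gn] := fP n; have [_ Gm] := fP m.
by apply: (Ginj _ _ (f n)) => //; rewrite fnm.
Qed.

(** Zorn's lemma gives a maximal graph [G] of a partial injection. If it missed both some [x0] in
    [A] and some [y0] in [B], the pair [(x0, y0)] could be added. *)
Lemma card_le_total (T U : Type) (A : set T) (B : set U) : A #<= B \/ B #<= A.
Proof.
pose P : set (set (T * U)) := [set G | [/\ G `<=` A `*` B,
  forall x x' y, G (x, y) -> G (x', y) -> x = x' &
  forall x y y', G (x, y) -> G (x, y') -> y = y']].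
have [|G [[GAB Ginj Gfun] Gmax]] := @Zorn_bigcup _ P.
  move=> F FP Ftot.
  have common u v : (\bigcup_(G in F) G) u -> (\bigcup_(G in F) G) v ->
      exists2 G, F G & G u /\ G v.
    move=> [G FG Gu] [H FH Hv]; have [GH|HG] := Ftot _ _ FG FH.
      by exists H => //; split=> //; exact: GH.
    by exists G => //; split=> //; exact: HG.
  split.
  - by move=> u [G /FP[GAB _ _] /GAB].
  - by move=> x x' y /common xy /xy[G /FP[_ Ginj _] []]; exact: Ginj.
  - by move=> x y y' /common xy /xy[G /FP[_ _ Gfun] []]; exact: Gfun.
have [Adom|/existsNP[x0 /not_implyP[Ax0 x0G]]] :=
    pselect (forall x, A x -> exists y, G (x, y)).
  left; apply/card_le_relP; exists (fun x y => G (x, y));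
    split=> [x /Adom[y Gxy]|].
    by exists y => //; have [] := GAB _ Gxy.
  by move=> x x' y _ _; exact: Ginj.
have [Bran|/existsNP[y0 /not_implyP[By0 y0G]]] :=
    pselect (forall y, B y -> exists x, G (x, y)).
  right; apply/card_le_relP; exists (fun y x => G (x, y));
    split=> [y /Bran[x Gxy]|].
    by exists x => //; have [] := GAB _ Gxy.
  by move=> y y' x _ _; exact: Gfun.
exfalso; apply: (Gmax (G `|` [set (x0, y0)])).
  split; first by left.
  by move=> /(_ (x0, y0) (or_intror erefl)) Gxy; apply: x0G; exists y0.
split.
- by move=> _ [/GAB//|->].
- move=> x x' y [Gxy|[-> ->]] [Gx'y|[]]; first exact: Ginj Gx'y.
  + by move=> _ yy0; exfalso; apply: y0G; exists x; rewrite -yy0.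
  + by exfalso; apply: y0G; exists x'.
  + by move=> ->.
- move=> x y y' [Gxy|[-> ->]] [Gxy'|[]]; first exact: Gfun Gxy'.
  + by move=> xx0; exfalso; apply: x0G; exists y; rewrite -xx0.
  + by exfalso; apply: x0G; exists y'.
  + by move=> ->.
Qed.

Lemma card_leX (T U V W : Type)
    (A : set T) (B : set U) (C : set V) (D : set W) :
  A #<= C -> B #<= D -> A `*` B #<= C `*` D.
Proof.
move=> /card_le_relP[G [GC Ginj]] /card_le_relP[H [HD Hinj]].
apply/card_le_relP; exists (fun u v => G u.1 v.1 /\ H u.2 v.2); split.
  move=> [x y] [/GC[z Cz Gxz] /HD[t Dt Hyt]].
  by exists (z, t).
move=> [x y] [x' y'] [z t] [/= Ax By] [/= Ax' By'] [/= Gxz Hyt] [/= Gx'z Hy't].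
by congr pair; [exact: Ginj Gx'z|exact: Hinj Hy't].
Qed.

(** The second coordinate, [p] or [q], records from which set a point comes and keeps the two images
    apart. *)
Lemma card_leU (T U : Type) (A B : set T) (C : set U) (p q : U) :
  C p -> C q -> p <> q -> A #<= C -> B #<= C -> A `|` B #<= C `*` C.
Proof.
move=> Cp Cq pq /card_le_relP[G [GC Ginj]] /card_le_relP[H [HC Hinj]].
apply/card_le_relP.
exists (fun x v =>
  A x /\ G x v.1 /\ v.2 = p \/ B x /\ H x v.1 /\ v.2 = q); split.
  move=> x [Ax|Bx].
    by have [y Cy Gxy] := GC _ Ax; exists (y, p) => //; left.
  by have [y Cy Hxy] := HC _ Bx; exists (y, q) => //; right.
move=> x x' [y r] _ _ [[Ax [Gxy /= rp]]|[Bx [Hxy /= rq]]]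
  [[Ax' [Gx'y /= r'p]]|[Bx' [Hx'y /= r'q]]].
- exact: Ginj Gx'y.
- by exfalso; apply: pq; rewrite -rp.
- by exfalso; apply: pq; rewrite -rq.
- exact: Hinj Hx'y.
Qed.

(** A point of [F i] goes to [i] paired with its image in [B]. A point lying in several [F i] may
    keep all its indices, since a relation is enough. *)
Lemma card_le_bigcup (I T U : Type) (D : set I) (F : I -> set T) (B : set U) :
  (forall i, D i -> F i #<= B) -> \bigcup_(i in D) F i #<= D `*` B.
Proof.
move=> FB; have {FB} /choice[G GP] i : exists G : T -> U -> Prop, D i ->
    (forall x, F i x -> exists2 y, B y & G x y) /\
    forall x x' y, F i x -> F i x' -> G x y -> G x' y -> x = x'.
  have [/FB/card_le_relP[G GP]|] := pselect (D i); first by exists G.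
  by exists (fun=> fun=> False).
apply/card_le_relP.
exists (fun x v => [/\ D v.1, F v.1 x & G v.1 x v.2]); split.
  move=> x [i Di Fix]; have [/(_ _ Fix)[y By Gxy] _] := GP _ Di.
  by exists (i, y).
move=> x x' [i y] _ _ [/= Di Fix Gxy] [/= _ Fix' Gx'y].
by have [_ Ginj] := GP _ Di; exact: Ginj Gx'y.
Qed.

(* Zorn's lemma is applied to the graphs of injections [A * A -> A], where [A]
   is infinite and is recovered as the domain of the graph. A maximal [A] has
   the cardinality of [M]: otherwise [M `\` A] contains a copy [A'] of [A], and
   the injection extends to [A `|` A'] by sending the new pairs into [A']. *)
Lemma card_setX_infinite (T : Type) (M : set T) :
  infinite_set M -> M `*` M #<= M.
Proof.
move=> Minf.
pose dm (G : set (T * T * T)) : set T := [set x | exists y z, G (x, y, z)].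
(* Infiniteness is asked of nonempty [G] only, because Zorn's lemma also requires the union of the
   empty chain to be in [P]. *)
pose P : set (set (T * T * T)) := [set G |
  [/\ dm G `<=` M,
      G !=set0 -> infinite_set (dm G),
      forall x y z, G (x, y, z) -> dm G y /\ dm G z,
      forall x y, dm G x -> dm G y -> exists z, G (x, y, z) &
      forall x y x' y' z, G (x, y, z) -> G (x', y', z) -> (x, y) = (x', y')]].
have dmS G H : G `<=` H -> dm G `<=` dm H.
  by move=> GH x [y [z /GH]]; exists y, z.
have [|G [[GM Ginf Gdm Gtot Ginj] Gmax]] := @Zorn_bigcup _ P.
  move=> F FP Ftot.
  have Fdm H : F H -> dm H `<=` dm (\bigcup_(G in F) G).
    by move=> FH; apply: dmS => u Hu; exists H.
  have dmF x : dm (\bigcup_(G in F) G) x -> exists2 G, F G & dm G x.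
    by move=> [y [z [G FG Gxyz]]]; exists G => //; exists y, z.
  split.
  - by move=> x /dmF[G /FP[GM _ _ _ _] /GM].
  - move=> [u [G FG Gu]]; have [_ Ginf _ _ _] := FP _ FG.
    by apply: sub_infinite_set (Ginf _); [exact: Fdm|exists u].
  - move=> x y z [G FG Gxyz]; have [_ _ Gdm _ _] := FP _ FG.
    by have [? ?] := Gdm _ _ _ Gxyz; split; apply: (Fdm _ FG).
  - move=> x y /dmF[G FG Gx] /dmF[H FH Hy].
    have [/dmS GH|/dmS HG] := Ftot _ _ FG FH.
      have [_ _ _ Htot _] := FP _ FH.
      by have [z Hxyz] := Htot x y (GH _ Gx) Hy; exists z, H.
    have [_ _ _ Gtot _] := FP _ FG.
    by have [z Gxyz] := Gtot x y Gx (HG _ Hy); exists z, G.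
  - move=> x y x' y' z [G FG Gz] [H FH Hz].
    have [GH|HG] := Ftot _ _ FG FH.
      by have [_ _ _ _ Hinj] := FP _ FH; apply: Hinj Hz; exact: GH.
    by have [_ _ _ _ Ginj] := FP _ FG; apply: Ginj Gz _; exact: HG.
(* A maximal [G] is nonempty: the pairing [pickle], carried to a copy of [nat] inside [M], is a
   member of [P] larger than the empty graph. *)
have {}Ginf : infinite_set (dm G).
  apply: Ginf; apply: contrapT => /set0P/negP/negPn/eqP G0.
  have [f [finj fM]] := infinite_set_inj_nat Minf.
  pose H := [set u | exists n m : nat, u = (f n, f m, f (pickle (n, m)))].
  have Hdm : dm H = range f.
    apply/seteqP; split=> [x [y [z [n [m [-> _ _]]]]]|_ [n _ <-]].
      by exists n.
    by exists (f 0%N), (f (pickle (n, 0%N))), n, 0%N.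
  apply: (Gmax H).
    rewrite G0; split; first exact: sub0set.
    move=> /(_ (f 0%N, f 0%N, f (pickle (0%N, 0%N)))); apply.
    by exists 0%N, 0%N.
  split; rewrite ?Hdm.
  - by move=> _ [n _ <-]; exact: fM.
  - move=> _; apply/infiniteP/card_le_relP; exists (fun n y => y = f n); split.
      by move=> n _; exists (f n); first by exists n.
    by move=> n m y _ _ -> /finj.
  - by move=> x y z [n [m [_ -> ->]]]; split; eexists.
  - by move=> _ _ [n _ <-] [m _ <-]; exists (f (pickle (n, m))), n, m.
  - move=> x y x' y' z [n [m [-> -> ->]]] [n' [m' [-> -> /finj]]].
    by move=> /(pcan_inj pickleK)[-> ->].
set A := dm G in GM Ginf Gdm Gtot.
have AA : A `*` A #<= A.
  apply/card_le_relP; exists (fun u z => G (u, z)); split.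
    move=> [x y] [/= Ax Ay]; have [z Gz] := Gtot _ _ Ax Ay.
    by exists z => //; have [] := Gdm _ _ _ Gz.
  by move=> [x y] [x' y'] z _ _; exact: Ginj.
have [p [q [Ap Aq pq]]] : exists p q, [/\ A p, A q & p <> q].
  have [f [finj fA]] := infinite_set_inj_nat Ginf.
  by exists (f 0%N), (f 1%N); split=> // /finj.
have [MA|AM] := card_le_total M A.
  apply: (card_le_trans _ (subset_card_le GM)); apply: (card_le_trans _ AA).
  exact: card_leX.
(* If the complement embeds in [A] too, then [M] is a union of two sets no larger than [A], hence no
   larger than [A] itself. *)
have [DA|] := card_le_total (M `\` A) A.
  have MA : M #<= A.
    apply: (card_le_trans _ AA); rewrite -(setDUK GM) //.
    exact: card_leU Ap Aq pq (card_lexx _) DA.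
  apply: (card_le_trans _ AM); apply: (card_le_trans _ AA).
  exact: card_leX.
move=> /card_le_subset[A' A'D]; rewrite card_eq_le => /andP[A'A AA'].
have A'NA x : A' x -> ~ A x by move=> /A'D[].
have A'M x : A' x -> M x by move=> /A'D[].
have BB : (A `|` A') `*` (A `|` A') #<= A'.
  apply: (card_le_trans _ AA'); apply: (card_le_trans _ AA); apply: card_leX;
  apply: (card_le_trans _ AA); exact: card_leU Ap Aq pq (card_lexx _) A'A.
have /card_le_relP[E [EA' Einj]] := BB.
(* Old pairs keep their values in [A] and new pairs get values in [A'], which is disjoint from [A];
   so injectivity can only fail within one kind, where [Ginj] or [Einj] applies. *)
pose H' := G `|` [set u | [/\ (A `|` A') u.1.1, (A `|` A') u.1.2,
  ~ (A u.1.1 /\ A u.1.2), A' u.2 & E u.1 u.2]].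
have newE x y : (A `|` A') x -> (A `|` A') y -> exists z, H' (x, y, z).
  move=> Bx By; have [[Ax Ay]|Nxy] := pselect (A x /\ A y).
    by have [z] := Gtot _ _ Ax Ay; exists z; left.
  by have [z A'z Ez] := EA' (x, y) (conj Bx By); exists z; right.
have H'dm : dm H' = A `|` A'.
  apply/seteqP; split=> [x [y [z [Gz|[]//]]]|x Bx].
    by left; exists y, z.
  by have [z ?] := newE x x Bx Bx; exists x, z.
exfalso; apply: (Gmax H').
  split; first by left.
  have /card_le_relP[E' [/(_ p Ap)[r A'r _] _]] := AA'.
  move=> H'G; apply: (A'NA r) => //.
  have : dm H' r by rewrite H'dm; right.
  by move=> [y [z /H'G]]; exists y, z.
split; rewrite ?H'dm.
- by move=> x [/GM|/A'M].
- by move=> _; apply: sub_infinite_set Ginf; left.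
- move=> x y z [Gz|[/= _ ? _ ? _]]; last by split=> //; right.
  by have [? ?] := Gdm _ _ _ Gz; split; left.
- exact: newE.
- move=> x y x' y' z [Gz|[/= Bx By _ A'z Ez]] [Gz'|[/= Bx' By' _ A'z' Ez']].
  + exact: Ginj Gz'.
  + by have [_ Az] := Gdm _ _ _ Gz; case: (A'NA z).
  + by have [_ Az] := Gdm _ _ _ Gz'; case: (A'NA z).
  + exact: Einj Ez'.
Qed.

(** An infinite product is no larger than its larger factor. If that factor is [C], it is infinite
    because [B] embeds in it. *)
Lemma card_setX_lt (T U V : Type) (A : set T) (B : set U) (C : set V) :
  infinite_set B -> ~ (A #<= B) -> ~ (A #<= C) -> ~ (A #<= B `*` C).
Proof.
move=> Binf AB AC ABC; have [BC|CB] := card_le_total B C.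
  have Cinf : infinite_set C by move=> /(card_le_finite BC).
  apply/AC/(card_le_trans ABC)/(card_le_trans _ (card_setX_infinite Cinf)).
  exact: card_leX.
apply/AB/(card_le_trans ABC)/(card_le_trans _ (card_setX_infinite Binf)).
exact: card_leX.
Qed.

(* Compare the indices by the cardinality of [F]. If some [F k] dominates
   uncountably many [F s], then these cannot cover [W]. Otherwise the sets
   [[set k | F k #<= F s]] with [s] in [S] are countable and cover [K]. *)
Lemma uncountably_many_avoid (K U : Type) (S : set K) (W : set U)
    (F : K -> set U) :
  ~ countable S -> ~ ([set: K] #<= S) -> [set: K] #<= W ->
  (forall k, ~ (W #<= F k)) ->
  exists2 w, W w & ~ countable [set k | ~ F k w].
Proof.
move=> Sunc KS KW WF; apply: contrapT => avoid.
have Winf (S' : set K) : ~ countable S' -> infinite_set S'.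
  by move=> unc /finite_set_countable.
(* By [avoid], no point of [W] lies outside all [F s] with [s] in the uncountable [S'], so these
   sets cover [W]; but their union embeds in the product of [S'] and [F k], which is too small. *)
have bounded (S' : set K) k : ~ countable S' -> ~ ([set: K] #<= S') ->
    ~ (forall s, S' s -> F s #<= F k).
  move=> S'unc KS' S'F; apply: (@card_setX_lt _ _ _ W S' (F k)) => //.
  - exact: Winf.
  - by move=> WS'; apply/KS'/(card_le_trans KW).
  apply: (card_le_trans _ (@card_le_bigcup _ _ _ S' F _ S'F)).
  apply: subset_card_le => w Ww; apply: contrapT => Fw; apply: avoid.
  exists w => // cw; apply/S'unc/(card_le_trans _ cw)/subset_card_le.
  by move=> s S's /= Fsw; apply: Fw; exists s.
have dominated s : countable [set k | F k #<= F s].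
  apply: contrapT => Tunc.
  (* The set of these [k] may be as large as [K], while [bounded] needs fewer indices; in that case
     a subset of the size of [S] is used instead. *)
  have [TS|/card_le_subset[S' S'T]] :=
      card_le_total [set k | F k #<= F s] S; last rewrite card_eq_le.
    apply: (bounded _ s Tunc) => [KT|//].
    by apply: KS; exact: card_le_trans KT TS.
  move=> /andP[S'S SS']; apply: (bounded S' s).
  - by move=> S'c; apply: Sunc; exact: card_le_trans SS' S'c.
  - by move=> KS'; apply: KS; exact: card_le_trans KS' S'S.
  - by move=> k /S'T.
have [[k Sk]|noub] := pselect (exists k, forall s, S s -> F s #<= F k).
  exact: (bounded S k).
(* [K] would be a union of countable sets indexed by [S], hence no larger than [S] times [nat]. *)
apply: (@card_setX_lt _ _ _ [set: K] S [set: nat]) => //; first exact: Winf.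
  by move=> Kc; apply: Sunc; exact: card_le_trans (card_leT _) Kc.
apply: (card_le_trans _
  (@card_le_bigcup _ _ _ S (fun s => [set k | F k #<= F s]) _
    (fun s _ => dominated s))).
apply: subset_card_le => k _; apply: contrapT => kS; apply: noub; exists k.
move=> s Ss; have [//|Fks] := card_le_total (F s) (F k).
by exfalso; apply: kS; exists s.
Qed.

Local Close Scope card_scope.

(** * Rademacher functions *)

Section Probability.
Context d (T : measurableType d) (R : realType) (mu : probability T R).

Lemma bounded_integrable (f : T -> R) (M : R) :
  measurable_fun setT f -> (forall x, `|f x| <= M) ->
  mu.-integrable setT (EFin \o f).
Proof.
move=> mf fM; apply: measurable_bounded_integrable => //.
  exact: (le_lt_trans (probability_le1 mu measurableT) (ltry _)).
by exists M; split; [exact: num_real|move=> N MN x _; apply: le_trans (ltW MN)].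
Qed.

Lemma Rintegral_sum (I : Type) (s : seq I)
    (F : I -> T -> R) :
  (forall i, mu.-integrable setT (EFin \o F i)) ->
  \int[mu]_x (\sum_(i <- s) F i x) = \sum_(i <- s) \int[mu]_x F i x.
Proof.
move=> intF; rewrite /Rintegral.
under eq_integral do rewrite -sumEFin.
rewrite integral_sum // -sum_fine // => i _.
by apply: integrable_fin_num => //; exact: intF.
Qed.

Lemma Rintegral_cst_probability (c : R) : \int[mu]_x c = c.
Proof.
rewrite Rintegral_cst //; have /= -> := @probability_setT _ _ _ mu.
by rewrite /= mulr1.
Qed.

Lemma L1_norm_Rintegral (f : T -> R) : L1_norm mu f = \int[mu]_x `|f x|.
Proof. by rewrite /L1_norm Lnorm1. Qed.

End Probability.

Section Rademacher.
Context (R : realType) (K : Type) (mu : probability (cube K) R).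

Definition rademacher (k : K) (x : cube K) : R := if x k then 1 else -1.

Lemma measurable_coord (k : K) :
  measurable_fun [set: cube K] (fun x : cube K => x k).
Proof.
move=> _ B mB; apply: sub_sigma_algebra; exists k => //.
by exists B.
Qed.

Lemma measurable_rademacher k : measurable_fun setT (rademacher k).
Proof. by apply: measurable_fun_ifT => //; exact: measurable_coord. Qed.

Lemma norm_rademacher k x : `|rademacher k x| = 1.
Proof. by rewrite /rademacher; case: (x k); rewrite ?normrN normr1. Qed.

Lemma rademacher_Lfun k : rademacher k \in Lfun mu 1.
Proof.
apply/Lfun1_integrable/(@bounded_integrable _ _ _ _ _ 1).
  exact: measurable_rademacher.
by move=> x; rewrite norm_rademacher.
Qed.

Definition rademacherL k : LfunType mu (lexx 1%E) :=
  Lfun_Sub (lexx 1%E) (rademacher_Lfun k).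

Lemma integrable_rademacherM k l :
  mu.-integrable setT (EFin \o (fun x => rademacher k x * rademacher l x)).
Proof.
apply: (@bounded_integrable _ _ _ _ _ 1).
  by apply: measurable_funM; exact: measurable_rademacher.
by move=> x; rewrite normrM !norm_rademacher mulr1.
Qed.

Lemma fair_pair (i j : K) (b : bool) : is_fair_product mu -> i <> j ->
  mu [set x : K -> bool | x i = b /\ x j = b] = (4^-1)%:E.
Proof.
move=> fair ij.
pose k (n : 'I_2) := if n == 0 then i else j.
have kinj : injective k.
  move=> [[|[|//]] p] [[|[|//]] q]; rewrite /k /= => e; apply: val_inj => //=;
  by case: ij.
have := fair 2%N k kinj (fun=> [set b]).
rewrite big_ord_recl big_ord1.
have -> : bernoulli_prob (2^-1 : R) [set b] = (2^-1)%:E.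
  rewrite bernoulli_probE; last by lra.
  have bE (c : bool) : (c \in [set b]) = (c == b) by apply/idP/eqP; rewrite inE.
  rewrite /unstable.onem !diracE !bE; case: b bE => _ /=;
    rewrite mule1 mule0 ?adde0 ?add0e //; congr EFin; lra.
rewrite -EFinM (_ : 2^-1 * 2^-1 = 4^-1 :> R); last by lra.
move=> <-; congr (mu _); apply/seteqP; split=> x /=.
  by move=> [xi xj] n; rewrite /k; case: ifP.
by move=> xk; have := xk ord0; have := xk ord_max.
Qed.

(** For [k <> l] the product is [2 * \1_A - 1], where [A] is the event that the two coordinates
    agree; it splits into two events of measure 1/4. *)
Lemma Rintegral_rademacherM (k l : K) : is_fair_product mu ->
  \int[mu]_x (rademacher k x * rademacher l x) = (`[< k = l >])%:R.
Proof.
move=> fair; case: asboolP => [<-|kl].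
  under eq_Rintegral => x _.
    rewrite (_ : _ * _ = 1); last first.
      by rewrite /rademacher; case: (x k); rewrite ?mulrNN mulr1.
    over.
  exact: Rintegral_cst_probability.
pose A : set (cube K) := [set x : K -> bool | x k = x l].
have prodE x : rademacher k x * rademacher l x = 2 * \1_A x - 1.
  rewrite /rademacher indicE; have [Axy|Axy] := pselect (A x).
    by rewrite mem_set // (Axy : x k = x l); case: (x l) => /=; lra.
  rewrite memNset //; move: Axy; rewrite /A /=.
  by case: (x k); case: (x l) => //= _; lra.
pose E (b : bool) : set (cube K) := [set x : K -> bool | x k = b /\ x l = b].
have mE b : measurable (E b).
  rewrite (_ : E b = (fun x : cube K => x k) @^-1` [set b] `&`
    (fun x : cube K => x l) @^-1` [set b]) //.
  by apply: measurableI; rewrite -[X in measurable X]setTI;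
    exact: measurable_coord.
have AE : A = E true `|` E false.
  apply/seteqP; split=> x; rewrite /A /E /=.
    by move=> <-; case: (x k); [left|right].
  by move=> [] [xk xl]; rewrite xk xl.
have mA : measurable A by rewrite AE; exact: measurableU.
have muE b : mu (E b) = (4^-1)%:E by exact: fair_pair.
have muA : mu A = (2^-1)%:E.
  rewrite AE; transitivity (mu (E true) + mu (E false))%E.
    apply: measureU => //.
    by apply/seteqP; split=> // x [[/= xk _] [/= xk' _]]; rewrite xk in xk'.
  rewrite !muE -EFinD; congr EFin; lra.
under eq_Rintegral => x _ do rewrite prodE.
have int1 : mu.-integrable setT (EFin \o (\1_A : cube K -> R)).
  apply: (@bounded_integrable _ _ _ _ _ 1); first exact: measurable_indic.
  by move=> x; rewrite indicE; case: (_ \in _); rewrite ?normr0 ?normr1.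
rewrite RintegralB //; last 2 first.
  apply: (@bounded_integrable _ _ _ _ _ 2).
    by apply: measurable_funM => //; exact: measurable_indic.
  move=> x; rewrite indicE.
  by case: (_ \in _); rewrite ?mulr0 ?normr0 ?mulr1 ?ger0_norm; lra.
  by apply: (@bounded_integrable _ _ _ _ _ 1) => // x; rewrite normr1.
rewrite RintegralZl // Rintegral_cst_probability.
rewrite /Rintegral integral_indic // setIT.
have /= -> := muA; rewrite /= mulfV ?subrr //.
Qed.

(** Members of [LfunType] are functions rather than classes, so evaluation at [x] commutes with
    sums. *)
Lemma sum_rademacherE n (a : 'I_n -> R) (k : 'I_n -> K) x :
  (\sum_(i < n) a i *: rademacherL (k i) : LfunType mu (lexx 1%E)) x =
  \sum_(i < n) a i * rademacher (k i) x.
Proof.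
pose ev (f : LfunType mu (lexx 1%E)) := f x.
by rewrite -[LHS]/(ev _) (big_morph ev (id1 := 0) (op1 := +%R)).
Qed.

Lemma L1_norm_rademacher k : L1_norm mu (rademacherL k) = 1.
Proof.
rewrite L1_norm_Rintegral -[RHS](Rintegral_cst_probability mu).
apply: eq_Rintegral => x _.
exact: norm_rademacher.
Qed.

(* Orthonormality gives [\int f ^ 2 <= m ^ 2], and [2 |f| <= m + f ^ 2 / m]. *)
Lemma L1_norm_sum_rademacher (m : nat) (a : 'I_(m ^ 2) -> R)
    (k : 'I_(m ^ 2) -> K) : is_fair_product mu -> injective k ->
  (forall i, `|a i| <= 1) ->
  L1_norm mu (\sum_i a i *: rademacherL (k i) : LfunType mu (lexx 1%E)) <= m%:R.
Proof.
move=> fair kinj a1; set f : LfunType _ _ := \sum_i _.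
(* For [m = 0] the sum is empty; the main argument divides by [m]. *)
have [m0|m0] := posnP m.
  rewrite L1_norm_Rintegral.
  under eq_Rintegral => x _.
    rewrite sum_rademacherE big1 ?normr0; last first.
      by move=> i; have := ltn_ord i; rewrite {2}m0.
    over.
  by rewrite Rintegral_cst_probability.
pose F (ij : 'I_(m ^ 2) * 'I_(m ^ 2)) x :=
  a ij.1 * a ij.2 * (rademacher (k ij.1) x * rademacher (k ij.2) x).
have intF ij : mu.-integrable setT (EFin \o F ij).
  have := integrableZl measurableT (a ij.1 * a ij.2)
    (integrable_rademacherM (k ij.1) (k ij.2)).
  by apply: eq_integrable => // x _; rewrite /= EFinM.
have f2E x : f x ^+ 2 = \sum_ij F ij x.
  rewrite sum_rademacherE expr2 big_distrlr /= pair_big /=.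
  by apply: eq_bigr => ij _; rewrite /F mulrACA.
have intf2 : mu.-integrable setT (EFin \o (fun x => f x ^+ 2)).
  have := @integrable_sum _ _ _ mu setT measurableT _ (index_enum _) xpredT _
    (fun ij _ => intF ij).
  by apply: eq_integrable => // x _; rewrite /= f2E sumEFin.
have f2 : \int[mu]_x (f x ^+ 2) <= (m ^ 2)%:R.
  under eq_Rintegral do rewrite f2E.
  rewrite Rintegral_sum //.
  (* With [m ^ 2] as a double sum of Kronecker deltas the comparison is termwise: off-diagonal
     integrals vanish and diagonal terms are at most 1. *)
  have -> : (m ^ 2)%:R = \sum_(i < m ^ 2) \sum_(j < m ^ 2) (i == j)%:R :> R.
    rewrite -[in LHS](card_ord (m ^ 2)) -sumr_const; apply: eq_bigr => i _.
    rewrite (bigD1 i) //= eqxx big1 ?addr0 // => j /negPf.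
    by rewrite eq_sym => ->.
  rewrite pair_big; apply: ler_sum => -[i j] _ /=.
  rewrite RintegralZl //; last exact: integrable_rademacherM.
  rewrite Rintegral_rademacherM //=.
  case: asboolP => [/kinj ij|kij]; last first.
    by rewrite mulr0.
  rewrite ij eqxx mulr1 (le_trans (ler_norm _)) // normrM.
  by rewrite mulr_ile1.
have m0R : 0 < m%:R :> R by rewrite ltr0n.
have intc (c : R) : mu.-integrable setT (EFin \o (fun=> c)).
  by apply: (@bounded_integrable _ _ _ _ _ `|c|).
have intg : mu.-integrable setT (EFin \o (fun x => (2 * m%:R)^-1 * f x ^+ 2)).
  have := integrableZl measurableT (2 * m%:R)^-1 intf2.
  by apply: eq_integrable => // x _; rewrite /= EFinM.
rewrite L1_norm_Rintegral.
apply: (@le_trans _ _ (\int[mu]_x (m%:R / 2 + (2 * m%:R)^-1 * f x ^+ 2))).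
  apply: le_Rintegral => //.
  - by apply: integrable_norm; apply/Lfun1_integrable; exact: LfunP.
  - have := integrableD measurableT (intc (m%:R / 2)) intg.
    by apply: eq_integrable.
  - move=> x _; rewrite -(ler_pM2l (_ : 0 < 2 * m%:R)) ?mulr_gt0 //.
    rewrite mulrDr mulVKf ?gt_eqF ?mulr_gt0 //.
    rewrite -(real_normK (num_real (f x))) -subr_ge0.
    have -> : 2 * m%:R * (m%:R / 2) + `|f x| ^+ 2 - 2 * m%:R * `|f x| =
      (m%:R - `|f x|) ^+ 2 by field.
    exact: sqr_ge0.
rewrite RintegralD // Rintegral_cst_probability RintegralZl //.
apply: (@le_trans _ _ (m%:R / 2 + (2 * m%:R)^-1 * (m ^ 2)%:R)).
  by rewrite lerD2l ler_pM2l // invr_gt0 mulr_gt0.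
rewrite natrX le_eqVlt; apply/orP; left; apply/eqP; field.
by rewrite gt_eqF.
Qed.

Lemma countable_rademacher
    (phi : {linear LfunType mu (lexx 1%E) -> R^o}) (M : R) :
  is_fair_product mu -> (forall f, `|phi f| <= M * L1_norm mu f) ->
  countable [set k | phi (rademacherL k) <> 0].
Proof.
move=> fair phiM.
(* A nonzero value reaches some threshold [1 / (n + 1)], so it suffices that each threshold is
   reached finitely often. *)
have -> : [set k | phi (rademacherL k) <> 0] =
    \bigcup_(n in [set: nat])
      [set k | n.+1%:R^-1 <= `|phi (rademacherL k)| :> R].
  apply/seteqP; split=> k /=.
    move=> /eqP; rewrite -normr_gt0 => phi0.
    exists (Num.truncn `|phi (rademacherL k)|^-1) => //=.
    rewrite -[leRHS]invrK lef_pV2 ?posrE ?invr_gt0 //.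
    by apply/ltW; rewrite truncnS_gt.
  move=> [n _ /= phin] phi0; move: phin.
  by rewrite phi0 normr0 leNgt invr_gt0 ltr0n.
apply: bigcup_countable => // n _; apply: finite_set_countable.
apply: contrapT => /infinite_set_inj_nat[f [finj fP]].
(* This choice makes [m ^ 2 / (n + 1) <= |M| * m] impossible. The absolute value is taken because
   the sign of [M] is unknown. *)
have [m mM] : exists m : nat, `|M| * n.+1%:R < m%:R :> R.
  exists (Num.truncn (`|M| * n.+1%:R)).+1; exact: truncnS_gt.
have m0 : 0 < m%:R :> R by apply: le_lt_trans mM; rewrite mulr_ge0.
pose k (i : 'I_(m ^ 2)) := f i.
have kinj : injective k by move=> i j /finj/val_inj.
(* The signs prevent cancellation: each term of the image under [phi] becomes an absolute value. *)
pose a i := Num.sg (phi (rademacherL (k i))).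
have a1 i : `|a i| <= 1 by rewrite normr_sg; case: (_ != _).
have L1m := L1_norm_sum_rademacher fair kinj a1.
have phi_le : `|phi (\sum_i a i *: rademacherL (k i))| <= `|M| * m%:R.
  apply: (le_trans (phiM _)); apply: le_trans (ler_wpM2l _ L1m) => //.
  by rewrite ler_wpM2r ?ler_norm // L1_norm_Rintegral Rintegral_ge0.
have phi_ge : (m ^ 2)%:R * n.+1%:R^-1 <= phi (\sum_i a i *: rademacherL (k i)).
  rewrite linear_sum /= mulr_natl -{1}(card_ord (m ^ 2)) -sumr_const.
  apply: ler_sum => i _; rewrite linearZ.
  rewrite -[leRHS]/(Num.sg (phi _) * phi (rademacherL (k i))) -normrEsg.
  exact: fP.
have := le_trans phi_ge (le_trans (ler_norm _) phi_le).
rewrite ler_pdivrMr ?ltr0n // mulrAC natrX expr2 ler_pM2r // leNgt.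
by rewrite mM.
Qed.
End Rademacher.

(** * Continuous functionals and the dual norm *)

Lemma dual_norm_le (R : realType) (X : normedModType R) (phi : X -> R^o) x :
  dual_space phi -> `|phi x| <= dual_norm phi * `|x|.
Proof.
move=> [philin phic].
pose L : {linear X -> R^o} :=
  HB.pack phi (GRing.isLinear.Build _ _ _ _ phi philin).
have [x0|x0] := eqVneq x 0.
  by rewrite x0 -[phi]/(L : X -> R^o) linear0 !normr0 mulr0.
have nx0 : 0 < `|x| by rewrite normr_gt0.
have : \forall r \near +oo, forall x, `|L x| <= r * `|x|.
  exact/linear_boundedP/linear_bounded_continuous.
move=> /pinfty_ex_gt0[r r0 Lr].
rewrite -ler_pdivrMr //; apply: ub_le_sup.
  (* The supremum dominates its members only if they are bounded above; continuity gives the bound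
     [r]. *)
  exists r => _ [y /= y1 <-]; apply: (le_trans (Lr y)).
  by rewrite ler_piMr // ltW.
exists (`|x|^-1 *: x) => /=.
  by rewrite normrZ normfV normr_id mulVf ?gt_eqF.
rewrite -[phi]/(L : X -> R^o) linearZ normrZ normfV normr_id mulrC //.
Qed.

(** If [phi] were nonzero somewhere, the open set where it does not vanish would meet the span of
    [Z], on which linearity makes it vanish. *)
Lemma dual_eq0_of_linearly_dense (R : realType) (X : normedModType R)
    (phi : X -> R^o) (Z : set X) :
  dual_space phi -> linearly_dense Z -> (forall z, Z z -> phi z = 0) ->
  forall x, phi x = 0.
Proof.
move=> [philin phic] Zd phi0 x.
pose L : {linear X -> R^o} :=
  HB.pack phi (GRing.isLinear.Build _ _ _ _ phi philin).
apply/eqP/negPn/negP => /eqP phix.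
have [||y [/= phiy [n [a [z [zZ yE]]]]]] := Zd (phi @^-1` [set~ 0]).
- by exists x.
- apply: open_comp => [z _|]; first exact: phic.
  apply: closed_openC; apply: compact_closed; last exact: compact_set1.
  exact: (@norm_hausdorff R R^o).
apply: phiy; rewrite yE -[phi]/(L : X -> R^o) linear_sum big1 // => i _.
rewrite linearZ; have -> : L (z i) = 0 by exact: phi0.
exact: scaler0.
Qed.

Lemma dual_norm0 (R : realType) (X : normedModType R) (phi : X -> R^o) :
  (forall x, phi x = 0) -> dual_norm phi = 0.
Proof.
move=> phi0; rewrite /dual_norm (_ : [set _ | _ in _] = [set 0]) ?sup1 //.
apply/seteqP; split=> [_ [x _ <-]|_ ->] /=; first by rewrite phi0 normr0.
by exists 0; rewrite /= ?normr0 ?phi0 ?normr0.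
Qed.

(** * Overcomplete sets against the images of the Rademacher functions *)

Unset Implicit Arguments.
Set Strict Implicit.

Theorem corollary32 (R : realType) (K : Type) (le : rel K)
    (mu : probability (cube K) R) (X : completeNormedModType R) :
  is_cardinal le -> omega1_lt le -> uncountable_cofinality le ->
  is_fair_product mu ->
  has_density X [set: K] -> dual_contains_L1 X mu ->
  ~ exists Y : set X, overcomplete Y.
Proof.
move=> [_ cardK] [w [Sunc _]] _ fair [_ Kmin] [J [c [C [c0 C0 Jdual Jnorm]]]].
move=> [Y [[[D Ddense DY] _] Yover]].
have KY : ([set: K] #<= Y)%card.
  apply: (card_le_trans (Kmin _ Ddense)).
  by move: DY; rewrite card_eq_le => /andP[].
pose F k := Y `&` [set y | J (rademacherL mu k) y = 0].
(* This segment stands for omega_1 in the counting argument: it is uncountable, yet smaller than the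
   cardinal [K]. *)
have KS : ~ ([set: K] #<= initial_segment le w)%card.
  by move=> KS; apply: (cardK w); rewrite card_eq_le KS card_leT.
(* Otherwise [F k] is linearly dense and [J] sends a function of norm 1 to the zero functional,
   against the lower bound [c]. *)
have YF k : ~ (Y #<= F k)%card.
  move=> YF; have FY : (F k #= Y)%card.
    by rewrite card_eq_le YF andbT; apply: subset_card_le => y [].
  have Fdense := Yover _ (@subIsetl _ _ _) FY.
  have J0 := dual_eq0_of_linearly_dense (Jdual _) Fdense (fun y Fy => Fy.2).
  have /andP[+ _] := Jnorm (rademacherL mu k).
  by rewrite (dual_norm0 J0) L1_norm_rademacher mulr1 leNgt c0.
have [y Yy yunc] := uncountably_many_avoid Sunc KS KY YF.
(* Applying [J] and then evaluating at [y] is a functional of norm at most [C * |y|], hence nonzero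
   on only countably many Rademacher functions, which contradicts [yunc]. *)
have evlin : linear (fun f => J f y : R^o) by move=> a f g; rewrite linearP.
pose ev : {linear LfunType mu (lexx 1%E) -> R^o} :=
  HB.pack (fun f => J f y : R^o) (GRing.isLinear.Build _ _ _ _ _ evlin).
have evC f : `|ev f| <= C * `|y| * L1_norm mu f.
  apply: (le_trans (dual_norm_le _ (Jdual f))).
  by rewrite mulrAC ler_wpM2r //; have /andP[] := Jnorm f.
apply: yunc; apply: sub_countable (countable_rademacher fair evC).
by apply: subset_card_le => k /= NF Jky; apply: NF.
Qed.
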